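(* Let $f,g_1,\ldots,g_r\in\mathbb{R}[x_1,\ldots,x_n]$, let $X=\{x\in\mathbb{R}^n: g_1(x)\ge 0,\ldots,g_r(x)\ge 0\}$, and suppose $X\subset B(R)$ with $R>0$. Let $C,\mathcal{L}>0$ be constants such that $$\max\{0,-g_1(x),\ldots,-g_r(x)\}\ge C\,\operatorname{dist}(x,X)^{\mathcal{L}}\quad\text{for all }x\in B(R).$$ Take $M,A\in\mathbb{R}$ with $$M\ge\max\{1,\mathbb{A}(f,R),\mathbb{B}(f,R)\},\qquad A\ge\max\{1,\mathbb{A}(g_i,R)\}\quad\text{for } i=1,\ldots,r.$$ Let $\epsilon>0$ and set $$\varphi(t)=\left(\frac{1}{A}t-1+\frac{\delta}{2A}\right)^{2N},$$ where $\delta\in\mathbb{R}$ and the integer $N\ge 0$ satisfy $$0<\delta\le\min\left\{A,\,C\left(\frac{\epsilon}{2M}\right)^{\mathcal{L}}\right\},\qquad N\ge\max\left\{\frac{(r-1)A-1}{2},\ \frac{A(2M+1-\delta)}{\delta^2},\ \frac{2rA-\epsilon}{2\epsilon}\right\}.$$ Then the polynomial $h(x)=\sum_{i=1}^r\varphi(g_i(x))g_i(x)$ satisfies: (1) $0\le h(x)<\epsilon$ for every $x\in X$; (2) for every $y\in\mathbb{R}^n$ with $|y|\le R$ there exists $x\in X$ such that $f(y)-h(y)\ge f(x)-h(x)-\epsilon$.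
   Context: $|\cdot|$ is the Euclidean norm, $B(R)=\{x\in\mathbb{R}^n:|x|\le R\}$, and $\operatorname{dist}(x,X)=\inf_{y\in X}|x-y|$ (with $\inf\emptyset=+\infty$). For a polynomial $h(x)=\sum_{j=0}^d\sum_{|\nu|=j}a_\nu x^\nu\in\mathbb{R}[x_1,\ldots,x_n]$ (multi-index notation, $|\nu|=\nu_1+\cdots+\nu_n$) and $R>0$, one sets $\mathbb{A}(h,R)=\sum_{j=0}^d\sum_{|\nu|=j}|a_\nu|R^j$ and $\mathbb{B}(h,R)=\sum_{j=1}^d\sum_{|\nu|=j}j|a_\nu|R^{j-1}$. *)

(* Defs.v *)
From HB Require Import structures.
From mathcomp Require Import all_boot all_order all_algebra.
From mathcomp Require Import boolp classical_sets reals ereal exp.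
From mathcomp Require mpoly.
(* The notations of [mpoly] cannot be imported together with those of
   MathComp-Analysis (incompatible associativity declared at level 2); the two
   notations needed here are redeclared below with the same meaning. *)
Import -(notations) mpoly.

Set Implicit Arguments.
Unset Strict Implicit.
Unset Printing Implicit Defensive.

Import Order.TTheory GRing.Theory Num.Theory.

Local Open Scope classical_set_scope.
Local Open Scope ring_scope.

Notation "{ 'mpoly' T [ n ] }" := (mpoly n T)
  (at level 0, T, n at level 2, format "{ 'mpoly'  T [ n ] }") : type_scope.
(* For a row vector x : 'rV[R]_n, the value of p at x is written p.@[x 0]. *)
Notation "p .@[ v ]" := (@meval _ _ v p)
  (at level 1, format "p .@[ v ]") : ring_scope.

(* The Euclidean norm; the library norm `|x| on 'rV[R]_n is the sup norm. *)
Definition enorm (R : realType) (n : nat) (x : 'rV[R]_n) : R :=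
  Num.sqrt (\sum_(i < n) x 0 i ^+ 2).

Definition eball (R : realType) (n : nat) (rho : R) : set 'rV[R]_n :=
  [set x | enorm x <= rho].
Arguments eball {R} n rho.

(* Extended-real valued, so that the distance to the empty set is +oo. *)
Definition edistset (R : realType) (n : nat) (x : 'rV[R]_n)
    (X : set 'rV[R]_n) : \bar R :=
  ereal_inf [set (enorm (x - y))%:E | y in X].

(* msize p = d + 1 for p of degree d (and 0 for p = 0); mdeg m = |m|. *)
Definition normA (R : realType) (n : nat) (p : {mpoly R[n]}) (rho : R) : R :=
  \sum_(0 <= j < msize p) \sum_(m <- msupp p | mdeg m == j)
    `|mcoeff m p| * rho ^+ j.

Definition normB (R : realType) (n : nat) (p : {mpoly R[n]}) (rho : R) : R :=
  \sum_(1 <= j < msize p) \sum_(m <- msupp p | mdeg m == j)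
    j%:R * `|mcoeff m p| * rho ^+ j.-1.

Definition semialg (R : realType) (n r : nat) (g : 'I_r -> {mpoly R[n]}) :
    set 'rV[R]_n :=
  [set x | forall i : 'I_r, 0 <= (g i).@[x 0]].

Definition phi (R : realType) (A delta : R) (N : nat) : {poly R} :=
  (A^-1 *: 'X - 1 + (delta / (2 * A))%:P) ^+ (2 * N).

(* horner_alg q p is the polynomial p(q(x)). *)
Definition hpoly (R : realType) (n r : nat) (g : 'I_r -> {mpoly R[n]})
    (A delta : R) (N : nat) : {mpoly R[n]} :=
  \sum_(i < r) horner_alg (g i) (phi A delta N) * g i.

Lemma meval_horner_alg (R : realType) (n : nat) (p : {poly R})
    (q : {mpoly R[n]}) (v : 'I_n -> R) :
  (horner_alg q p).@[v] = p.[q.@[v]].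
Proof.
elim/poly_ind: p => [|p c IH]; first by rewrite rmorph0 meval0 horner0.
rewrite rmorphD rmorphM /= horner_algX horner_algC mevalD mevalM IH.
by rewrite hornerMXaddC mevalZ meval1 mulr1.
Qed.

Lemma meval_hpoly (R : realType) (n r : nat) (g : 'I_r -> {mpoly R[n]})
    (A delta : R) (N : nat) (v : 'I_n -> R) :
  (hpoly g A delta N).@[v] =
    \sum_(i < r)
      (A^-1 * (g i).@[v] - 1 + delta / (2 * A)) ^+ (2 * N) * (g i).@[v].
Proof.
rewrite /hpoly raddf_sum /=; apply: eq_bigr => i _.
by rewrite mevalM meval_horner_alg /phi !hornerE.
Qed.

(* Main.v *)
(** On [0, A] the map t |-> t phi(t) is at most q = A / (2N+1) <= epsilon / (2r),
    because u (1-u)^k <= 1 / (k+1) on [0, 1]; where t <= 0 it is nonpositive.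
    This gives 0 <= h <= r q < epsilon on X.  For y outside X, either some
    g_i(y) < - delta, and then Bernoulli's inequality makes
    phi(g_i(y)) g_i(y) <= - (2M+1), so that f - h is at least M at y; or all
    violations are at most delta, the Lojasiewicz inequality provides a point x
    of X with |y - x| barely above epsilon / (2M), and f is M-Lipschitz on the
    ball.  The Lipschitz bound is obtained monomial by monomial, by telescoping
    products. *)
Require Import Defs.
From HB Require Import structures.
From mathcomp Require Import all_boot all_order all_algebra.
From mathcomp Require Import boolp classical_sets reals ereal exp.
From mathcomp Require mpoly.
From mathcomp Require Import ring lra.
Import -(notations) mpoly.

Set Implicit Arguments.
Unset Strict Implicit.
Unset Printing Implicit Defensive.

Import Order.TTheory GRing.Theory Num.Theory.

Local Open Scope classical_set_scope.
Local Open Scope ring_scope.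

(** * Elementary estimates for [t * phi(t)] *)

Lemma bernoulli_ge (R : realFieldType) (u : R) (k : nat) :
  0 <= u -> 1 + k%:R * u <= (1 + u) ^+ k.
Proof.
move=> u0; elim: k => [|k IH]; first by rewrite mul0r addr0.
rewrite exprS; apply: le_trans (ler_wpM2l _ IH); last lra.
have := mulr_ge0 (ler0n R k) (sqr_ge0 u).
rewrite -natr1; nra.
Qed.

(** Since [u <= 1], one has [(k+1) u <= 1 + k u], and [(1 + k u) (1 - u)^k] does not increase with
    [k]. *)
Lemma mul_expr1B_le (R : realFieldType) (u : R) (k : nat) :
  0 <= u <= 1 -> u * (1 - u) ^+ k <= k.+1%:R^-1.
Proof.
move=> /andP[u0 u1]; have v0 : 0 <= 1 - u by rewrite subr_ge0.
have bnd : (1 + k%:R * u) * (1 - u) ^+ k <= 1.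
  elim: k => [|k IH]; first by rewrite mul0r addr0 mulr1.
  apply: le_trans IH; rewrite exprS mulrA ler_wpM2r ?exprn_ge0 //.
  have := mulr_ge0 (ler0n R k.+1) (sqr_ge0 u).
  by rewrite -natr1; nra.
rewrite -[leRHS]mul1r ler_pdivlMr ?ltr0Sn //; apply: le_trans bnd.
rewrite mulrAC ler_wpM2r ?exprn_ge0 // -natr1; lra.
Qed.

Lemma bump_le (R : realFieldType) (A delta t : R) (N : nat) :
  0 < A -> 0 <= delta <= A -> 0 <= t <= A ->
  (A^-1 * t - 1 + delta / (2 * A)) ^+ (2 * N) * t <= A / (2 * N).+1%:R.
Proof.
move=> A0 /andP[d0 dA] /andP[t0 tA].
have [u def_t] : exists u, t = A * u by exists (t / A); field; lra.
have [d def_d] : exists d, delta = 2 * A * d.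
  by exists (delta / (2 * A)); field; lra.
subst t delta; rewrite mulKf ?gt_eqF // (mulrC (2 * A)) mulfK; last lra.
have {}t0 : 0 <= u by rewrite pmulr_rge0 // in t0.
have {}tA : u <= 1 by rewrite -(ler_pM2l A0) mulr1.
have {}d0 : 0 <= d by rewrite pmulr_rge0 // in d0; lra.
have {}dA : 2 * d <= 1 by rewrite -(ler_pM2l A0) mulr1; lra.
rewrite mulrCA ler_pM2l // mulrC.
(* If [u - 1 + d <= 0], its absolute value is at most [1 - u] and the previous lemma applies.
   Otherwise it lies between 0 and [d <= 1/2], and Bernoulli's inequality gives
   [4^N >= 1 + 3N >= 2N + 1]. *)
case: (lerP (u - 1 + d) 0) => hu.
  have /(mul_expr1B_le (2 * N)) : 0 <= u <= 1 by rewrite t0.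
  apply: le_trans.
  by rewrite ler_wpM2l // !exprM lerXn2r ?nnegrE ?sqr_ge0 //; nra.
rewrite -[leRHS]mul1r ler_pM ?exprn_ge0 ?(ltW hu) //.
apply: (@le_trans _ _ (4^-1 ^+ N)).
  by rewrite exprM lerXn2r ?nnegrE ?sqr_ge0 ?invr_ge0 //; nra.
rewrite exprVn lef_pV2 ?posrE ?exprn_gt0 ?ltr0Sn //.
have := bernoulli_ge N (ler0n R 3); rewrite (_ : 1 + 3 = 4 :> R); last by ring.
rewrite -[(2 * N).+1%:R]natr1 natrM; have := ler0n R N; lra.
Qed.

(** * Coefficient norms as bounds on values and Lipschitz constants *)

Lemma sum_mdeg (R : realType) (n : nat) (p : {mpoly R[n]})
    (F : nat -> multinom n -> R) :
  \sum_(0 <= j < msize p) \sum_(m <- msupp p | mdeg m == j) F j m =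
  \sum_(m <- msupp p) F (mdeg m) m.
Proof.
under eq_bigr => j _ do rewrite big_mkcond.
rewrite exchange_big /=; apply: eq_big_seq => m /msize_mdeg_lt lt_m.
under eq_bigr => j _ do rewrite eq_sym.
by rewrite -big_mkcond big_nat1_eq lt_m.
Qed.

Lemma normAE (R : realType) (n : nat) (p : {mpoly R[n]}) (rho : R) :
  normA p rho = \sum_(m <- msupp p) `|mcoeff m p| * rho ^+ mdeg m.
Proof. exact: (sum_mdeg p (fun j m => `|mcoeff m p| * rho ^+ j)). Qed.

Lemma normBE (R : realType) (n : nat) (p : {mpoly R[n]}) (rho : R) :
  normB p rho =
  \sum_(m <- msupp p) (mdeg m)%:R * `|mcoeff m p| * rho ^+ (mdeg m).-1.
Proof.
rewrite -(sum_mdeg p (fun j m => j%:R * `|mcoeff m p| * rho ^+ j.-1)).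
rewrite /normB; case: (msize p) => [|k]; first by rewrite !big_geq.
rewrite [RHS]big_ltn // [X in _ = X + _]big1 ?add0r // => m _.
by rewrite !mul0r.
Qed.

(* What a product of [d] factors of absolute value at most [rho] satisfies when
   each factor is moved by at most [D]. *)
Definition close_prods (R : realType) (rho D u v : R) (d : nat) : Prop :=
  [/\ `|u| <= rho ^+ d, `|v| <= rho ^+ d &
      `|u - v| <= d%:R * rho ^+ d.-1 * D].

Section CloseProducts.
Context (R : realType) (rho D : R).

Lemma close_prods1 : close_prods rho D 1 1 0.
Proof. by split; rewrite ?normr1 // subrr normr0 !mul0r. Qed.

Lemma close_prodsM (u u' v v' : R) (d e : nat) :
  close_prods rho D u v d -> close_prods rho D u' v' e ->
  close_prods rho D (u * u') (v * v') (d + e).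
Proof.
move=> [hu hv huv] [hu' hv' huv']; split.
- by rewrite normrM exprD ler_pM.
- by rewrite normrM exprD ler_pM.
have -> : u * u' - v * v' = (u - v) * v' + u * (u' - v') by ring.
have -> : (d + e)%:R * rho ^+ (d + e).-1 * D =
    d%:R * rho ^+ d.-1 * D * rho ^+ e + rho ^+ d * (e%:R * rho ^+ e.-1 * D).
  (* When [d] or [e] is 0 the truncated predecessor gives a wrong exponent, but its numerical factor
     vanishes. *)
  case: d e {hu hv huv hu' hv' huv'} => [|d] [|e].
  - by rewrite !mul0r mulr0 addr0.
  - by rewrite expr0 add0n mul1r !mul0r add0r.
  - by rewrite addn0 expr0 !mul0r mulr0 mulr1 addr0.
  by rewrite natrD addSn /= !exprD !exprS; ring.
by rewrite (le_trans (ler_normD _ _)) // lerD // normrM ler_pM.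
Qed.

Context (n : nat) (x y : 'I_n -> R).
Hypotheses (hx : forall i, `|x i| <= rho) (hy : forall i, `|y i| <= rho).
Hypothesis (hxy : forall i, `|x i - y i| <= D).

Lemma close_monomials (m : multinom n) :
  close_prods rho D (\prod_i x i ^+ m i) (\prod_i y i ^+ m i) (mdeg m).
Proof.
rewrite mdegE; apply: big_ind3 => [||i _]; first exact: close_prods1.
  by move=> *; apply: close_prodsM.
elim: (m i) => [|k IH]; first exact: close_prods1.
rewrite !exprS -add1n; apply: close_prodsM IH.
by split; rewrite ?expr1 // mulr1 mul1r.
Qed.

Lemma meval_dist_le_normB (p : {mpoly R[n]}) :
  `|p.@[x] - p.@[y]| <= normB p rho * D.
Proof.
rewrite !mevalE normBE -sumrB mulr_suml.
rewrite (le_trans (ler_norm_sum _ _ _)) // ler_sum // => m _.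
rewrite -mulrBr normrM (mulrC (_%:R)) -!mulrA ler_wpM2l // mulrA.
by have [] := close_monomials m.
Qed.

End CloseProducts.

Lemma enorm_ge0 (R : realType) (n : nat) (x : 'rV[R]_n) : 0 <= enorm x.
Proof. exact: sqrtr_ge0. Qed.

Lemma coord_le_enorm (R : realType) (n : nat) (x : 'rV[R]_n) (i : 'I_n) :
  `|x 0 i| <= enorm x.
Proof.
rewrite /enorm -sqrtr_sqr ler_wsqrtr // (bigD1 i) //= lerDl.
by rewrite sumr_ge0 // => j _; apply: sqr_ge0.
Qed.

Lemma eball_meval_le (R : realType) (n : nat) (p : {mpoly R[n]}) (rho : R)
    (x : 'rV[R]_n) :
  enorm x <= rho -> `|p.@[x 0]| <= normA p rho.
Proof.
move=> xrho; rewrite mevalE normAE (le_trans (ler_norm_sum _ _ _)) //.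
apply: ler_sum => m _; rewrite normrM ler_wpM2l //.
have hx i : `|x 0 i| <= rho := le_trans (coord_le_enorm x i) xrho.
(* With both points equal and [D = 0], only the size bound of [close_monomials] matters. *)
have hxx i : `|x 0 i - x 0 i| <= 0 by rewrite subrr normr0.
by have [] := close_monomials hx hx hxx m.
Qed.

Lemma eball_lipschitz (R : realType) (n : nat) (p : {mpoly R[n]}) (rho : R)
    (x y : 'rV[R]_n) :
  enorm x <= rho -> enorm y <= rho ->
  `|p.@[x 0] - p.@[y 0]| <= normB p rho * enorm (x - y).
Proof.
move=> xrho yrho; apply: meval_dist_le_normB => i.
- exact: le_trans (coord_le_enorm x i) xrho.
- exact: le_trans (coord_le_enorm y i) yrho.
by have := coord_le_enorm (x - y) i; rewrite !mxE.
Qed.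

(** Were the distance at least [c], monotonicity of the power would give [C c^L <= G]. The empty set
    lies at distance +oo, so this also yields that [X] is nonempty. *)
Lemma edistset_near (R : realType) (n : nat) (X : set 'rV[R]_n)
    (y : 'rV[R]_n) (C L G c : R) :
  0 < C -> 0 < L -> 0 <= c ->
  (C%:E * edistset y X `^ L <= G%:E)%E -> G < C * c `^ L ->
  exists2 x, X x & enorm (y - x) < c.
Proof.
move=> C0 L0 c0 hG Gc.
have : (edistset y X < c%:E)%E.
  rewrite ltNge; apply/negP => hc; move: Gc; rewrite ltNge => /negP; apply.
  rewrite -lee_fin; apply: le_trans hG.
  rewrite EFinM lee_pmul2l // -poweR_EFin.
  apply: gt0_ler_poweR => //; first exact: ltW.
    by rewrite in_itv /= leey lee_fin c0.
  by rewrite in_itv /= leey andbT; apply: le_trans hc; rewrite lee_fin.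
by move=> /ereal_inf_lt[_ [x Xx <-]]; rewrite lte_fin; exists x.
Qed.

Theorem proposition2p3 (R : realType) (n r : nat)
    (f : {mpoly R[n]}) (g : 'I_r -> {mpoly R[n]})
    (rho : R) (hrho : 0 < rho) (hX : semialg g `<=` eball n rho)
    (C L : R) (hC : 0 < C) (hL : 0 < L)
    (hLoj : forall x : 'rV[R]_n, eball n rho x ->
      (C%:E * edistset x (semialg g) `^ L
         <= (\big[Num.max/0%R]_(i < r) - (g i).@[x 0%R])%:E)%E)
    (M A : R)
    (hM : Num.max 1 (Num.max (normA f rho) (normB f rho)) <= M)
    (hA : \big[Num.max/1]_(i < r) normA (g i) rho <= A)
    (epsilon : R) (hepsilon : 0 < epsilon)
    (delta : R) (hdelta0 : 0 < delta)
    (hdelta : delta <= Num.min A (C * (epsilon / (2 * M)) `^ L))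
    (N : nat)
    (hN : Num.max (((r%:R - 1) * A - 1) / 2)
            (Num.max (A * (2 * M + 1 - delta) / delta ^+ 2)
                     ((2 * r%:R * A - epsilon) / (2 * epsilon)))
          <= N%:R) :
  let h := hpoly g A delta N in
  (forall x : 'rV[R]_n, semialg g x -> 0 <= h.@[x 0] < epsilon) /\
  (forall y : 'rV[R]_n, enorm y <= rho ->
     exists2 x : 'rV[R]_n, semialg g x &
       f.@[y 0] - h.@[y 0] >= f.@[x 0] - h.@[x 0] - epsilon).
Proof.
move=> h; move: hM hN hdelta.
rewrite !ge_max le_min => /and3P[M1 MA MB] /and3P[N1 N2 N3] /andP[dA dC].
have A1 : 1 <= A by apply: le_trans hA; apply: bigmax_ge_id.
have A0 : 0 < A by lra.
have gA i (x : 'rV[R]_n) : enorm x <= rho -> `|(g i).@[x 0]| <= A.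
  move=> /eball_meval_le-/(_ (g i)) /le_trans; apply.
  by apply: le_trans hA; apply: (le_bigmax _ (fun i => normA (g i) rho)).
pose q : R := A / (2 * N).+1%:R.
have K0 : 0 < (2 * N).+1%:R :> R by [].
have q0 : 0 <= q by rewrite divr_ge0 // ltW.
(* All terms of [h] but one will add up to at most 1. *)
have qr1 : (r%:R - 1) * q <= 1.
  rewrite mulrA ler_pdivrMr // mul1r -[(2 * N).+1%:R]natr1 natrM.
  by move: N1; rewrite ler_pdivrMr //; lra.
have qeps : 2 * r%:R * q <= epsilon.
  rewrite mulrA ler_pdivrMr // -[(2 * N).+1%:R]natr1 natrM.
  by move: N3; rewrite ler_pdivrMr; lra.
pose s i (x : 'rV[R]_n) := (A^-1 * (g i).@[x 0] - 1 + delta / (2 * A)) ^+ (2 * N).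
pose w i (x : 'rV[R]_n) : R := s i x * (g i).@[x 0].
have hE (x : 'rV[R]_n) : h.@[x 0] = \sum_i w i x by rewrite /h meval_hpoly.
have s0 i (x : 'rV[R]_n) : 0 <= s i x by rewrite /s exprM exprn_ge0 // sqr_ge0.
have w_ge0 i (x : 'rV[R]_n) : 0 <= (g i).@[x 0] -> 0 <= w i x.
  exact: mulr_ge0.
have w_le0 i (x : 'rV[R]_n) : (g i).@[x 0] <= 0 -> w i x <= 0.
  exact: mulr_ge0_le0.
have w_le i (x : 'rV[R]_n) : enorm x <= rho -> w i x <= q.
  move=> /gA-/(_ i); rewrite ler_norml => /andP[_ gi].
  have [g0|/ltW /w_le0 w0] := leP 0 (g i).@[x 0]; last exact: le_trans q0.
  by apply: bump_le => //; rewrite ?g0 // (ltW hdelta0).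
have h_ge0 (x : 'rV[R]_n) : semialg g x -> 0 <= h.@[x 0].
  by move=> gx; rewrite hE sumr_ge0 // => i _; apply/w_ge0/gx.
split=> [x gx|y yrho].
  rewrite h_ge0 //= (@le_lt_trans _ _ (r%:R * q)) //; last lra.
  rewrite hE -[r in r%:R]card_ord -sum1_card natr_sum mulr_suml ler_sum // => i _.
  by rewrite mul1r w_le // hX.
have [gy|] := pselect (semialg g y); first by exists y => //; lra.
move=> /existsNP[i0 /negP]; rewrite -ltNge => gi0.
have r1 : 1 <= r%:R :> R by rewrite ler1n (leq_ltn_trans _ (ltn_ord i0)).
have h_le i : h.@[y 0] <= w i y + (r%:R - 1) * q.
  rewrite hE (bigD1 i) //= lerD2l.
  have -> : (r%:R - 1) * q = \sum_(j < r | j != i) q.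
    rewrite sumr_const cardC1 card_ord -subn1 -[q *+ _]mulr_natl.
    by rewrite natrB // -(ler1n R).
  by apply: ler_sum => j _; apply: w_le.
have := hLoj y yrho; set G := \big[Num.max/0]_(i < r) _ => hG.
have [[i gi]|/forallNP no_i] := pselect (exists i, delta < - (g i).@[y 0]).
  have G0 : 0 <= G by apply: bigmax_ge_id.
  (* Any point of the set will do here; the radius is chosen so that [C c^L = G + 1 > G]. *)
  have [x gx _] : exists2 x, semialg g x &
      enorm (y - x) < ((G + 1) / C) `^ L^-1.
    apply: edistset_near hG _; rewrite ?powR_ge0 // -powRrM.
    rewrite mulVf ?gt_eqF // powRr1 ?divr_ge0 ?addr_ge0 // ?ltW //.
    by rewrite mulrC divfK ?gt_eqF // ltrDl.
  exists x => //; have hx0 := h_ge0 x gx; have hi := h_le i.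
  have := eball_meval_le f yrho; have := eball_meval_le f (hX _ gx).
  rewrite !ler_norml => /andP[_ fx] /andP[fy _].
  (* Then [h(y) <= -2M], so [f(y) - h(y) >= M >= f(x) >= f(x) - h(x)]. *)
  suff : w i y <= - (2 * M + 1) by lra.
  have Nd : 2 * M + 1 - delta <= N%:R * delta ^+ 2 / A.
    move: N2; rewrite ler_pdivrMr ?exprn_gt0 // => N2.
    by rewrite ler_pdivlMr // mulrC.
  suff s1 : 1 + N%:R * delta / A <= s i y.
    have : (1 + N%:R * delta / A) * delta <= s i y * - (g i).@[y 0].
      apply: ler_pM => //; rewrite ?addr_ge0 ?divr_ge0 ?mulr_ge0 //; lra.
    rewrite mulrN -/(w i y).
    have -> : (1 + N%:R * delta / A) * delta = delta + N%:R * delta ^+ 2 / A.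
      by ring.
    lra.
  pose a := delta / (2 * A).
  have a0 : 0 <= a by rewrite divr_ge0; lra.
  have -> : N%:R * delta / A = (2 * N)%:R * a.
    by rewrite natrM /a; field; lra.
  apply: le_trans (bernoulli_ge _ a0) _.
  rewrite /s -/a !exprM lerXn2r ?nnegrE ?sqr_ge0 //.
  (* This puts the base of the power in [s i y] at or below [-(1 + a)], so its square is at least
     [(1 + a)^2]. *)
  have : A^-1 * (g i).@[y 0] <= - (2 * a).
    rewrite mulrC ler_pdivrMr //.
    have -> : - (2 * a) * A = - delta by rewrite /a; field; lra.
    lra.
  by nra.
(* As w i0 y <= 0, a slack of q remains in the estimate, which spares us the
   existence of a nearest point of X. *)
have Gd : G <= delta.
  apply: bigmax_le => [|i _]; first exact: ltW.
  by rewrite leNgt; apply/negP/no_i.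
have M0 : 0 < M by lra.
have Q0 : 0 < q by rewrite divr_gt0.
pose c := epsilon / (2 * M).
have c0 : 0 <= c by rewrite divr_ge0; lra.
(* The bound on [delta] only gives [G <= C c^L]; enlarging [c] by [q / M] makes it strict and costs
   [q] in the Lipschitz estimate for [f]. *)
have cq : c < c + q / M by rewrite ltrDl divr_gt0.
have [x gx xy] : exists2 x, semialg g x & enorm (y - x) < c + q / M.
  apply: edistset_near hG _ => //; first exact: le_trans (ltW cq).
  apply: le_lt_trans Gd (le_lt_trans dC _).
  by rewrite ltr_pM2l // gt0_ltr_powR // nnegrE ltW // (le_lt_trans c0).
exists x => //; have hx0 := h_ge0 x gx.
have hi0 := h_le i0; have wi0 := w_le0 i0 y (ltW gi0).
have := eball_lipschitz f yrho (hX _ gx); rewrite ler_norml => /andP[fxy _].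
have : normB f rho * enorm (y - x) <= M * (c + q / M).
  apply: (@le_trans _ _ (M * enorm (y - x))).
    by rewrite ler_wpM2r ?enorm_ge0.
  by rewrite ler_pM2l // ltW.
(* The total loss is [epsilon/2 + q] from [f] and [(r-1) q] from [h(y)], that is
   [epsilon/2 + r q <= epsilon]. *)
have -> : M * (c + q / M) = epsilon / 2 + q by rewrite /c; field; lra.
lra.
Qed.
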